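(* Let $q$ be a prime power and suppose there is a $q$-ary Singleton-optimal $[n,k,d;r]$-locally repairable code with $r\ge2$, $r<k$, $n\ge2(r+1)$, $d\ge3$. If $d=\Omega(n)$, then $n=O(q)$. More precisely, if $d=\lambda n$ for some real $0<\lambda<1$, then $n\le \frac{2q}{\lambda}$.
   Context: An $[n,k,d;r]$-locally repairable code over $\mathbb{F}_q$ is a linear code $\mathcal{C}\subseteq\mathbb{F}_q^n$ of dimension $k$ and minimum Hamming distance $d$ with locality $r$: for every $i\in[n]=\{1,\dots,n\}$ there is $I_i\subseteq[n]\setminus\{i\}$ with $|I_i|\le r$ such that any two codewords agreeing on $I_i$ also agree at $i$. For linear codes this is equivalent to: for every $i\in[n]$ there is $\mathbf{c}\in\mathcal{C}^\perp$ with $i\in\mathrm{supp}(\mathbf{c})$ and $|\mathrm{supp}(\mathbf{c})|\le r+1$. Such a code always satisfies $d\le n-k-\lceil k/r\rceil+2$ (Singleton-type bound) and is called Singleton-optimal if equality holds. $d=\Omega(n)$ means $d\ge\lambda n$ for a fixed $\lambda>0$; the constant in $n=O(q)$ then depends only on $\lambda$. *)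

(* Defs.v *)
From HB Require Import structures.
From mathcomp Require Import all_boot all_order all_algebra.
From mathcomp Require Import reals.
Set Implicit Arguments.
Unset Strict Implicit.
Unset Printing Implicit Defensive.
Import Order.TTheory GRing.Theory Num.Theory.
Local Open Scope ring_scope.

Definition hamming_dist (F : finFieldType) (n : nat) (u v : 'rV[F]_n) : nat :=
  #|[set i : 'I_n | u 0 i != v 0 i]|.

(* The zero code has no minimum distance: [is_min_dist 0%VS d] never holds. *)
Definition is_min_dist (F : finFieldType) (n : nat)
    (C : {vspace 'rV[F]_n}) (d : nat) : Prop :=
  (exists u v : 'rV[F]_n,
     [/\ u \in C, v \in C, u != v & hamming_dist u v = d]) /\
  (forall u v : 'rV[F]_n,
     u \in C -> v \in C -> u != v -> (d <= hamming_dist u v)%N).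

Definition has_locality (F : finFieldType) (n : nat)
    (C : {vspace 'rV[F]_n}) (r : nat) : Prop :=
  forall i : 'I_n, exists I : {set 'I_n},
    [/\ i \notin I, (#|I| <= r)%N &
        forall u v : 'rV[F]_n, u \in C -> v \in C ->
          (forall j : 'I_n, j \in I -> u 0 j = v 0 j) -> u 0 i = v 0 i].

Definition is_lrc (F : finFieldType) (n k d r : nat)
    (C : {vspace 'rV[F]_n}) : Prop :=
  [/\ \dim C = k, is_min_dist C d & has_locality C r].

(* Computed in [int], so that no subtraction is truncated. *)
Definition singleton_lrc_bound (n k r : nat) : int :=
  n%:Z - k%:Z - Num.ceil (k%:R / r%:R : rat) + 2.

Definition singleton_optimal_lrc (F : finFieldType) (n k d r : nat)
    (C : {vspace 'rV[F]_n}) : Prop :=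
  is_lrc k d r C /\ d%:Z = singleton_lrc_bound n k r.

(* Main.v *)
Require Import Defs.
From HB Require Import structures.
From mathcomp Require Import all_boot all_order all_algebra.
From mathcomp Require Import reals.
From mathcomp Require Import zify.
Set Implicit Arguments.
Unset Strict Implicit.
Unset Printing Implicit Defensive.
Import Order.TTheory GRing.Theory Num.Theory.
Local Open Scope ring_scope.

(** A Singleton-optimal code satisfies d <= 2q, whatever its length.  Adding
    repair groups greedily gives a set T of coordinates of rank at most k - 2
    with |T| >= (k - 2) + floor((k - 2) / r) >= n - d - 2.  The words of C
    vanishing on T contain a pencil of q + 1 nonzero words v, u + a v.  Each
    coordinate outside T is nonzero in at most q of them, so
    (q + 1) d <= q (n - |T|) <= q (d + 2). *)

Section Shortening.
Variables (F : finFieldType) (n : nat) (C : {vspace 'rV[F]_n}).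
Implicit Types (T : {set 'I_n}) (u v : 'rV[F]_n).

Definition coordinate (j : 'I_n) (u : 'rV[F]_n) : F^o := u 0 j.

Fact coordinate_is_linear j : linear (coordinate j).
Proof. by move=> a u v; rewrite /coordinate !mxE. Qed.

HB.instance Definition _ j :=
  GRing.isLinear.Build F 'rV[F]_n F^o *:%R (coordinate j)
    (coordinate_is_linear j).

(** The code shortened at [T], with the zero coordinates kept so that all these codes lie in one
    ambient space. The drop in dimension from [C] is the rank of the coordinates in [T]. *)
Definition shorten T : {vspace 'rV[F]_n} :=
  (C :&: \bigcap_(j in T) lker (linfun (coordinate j)))%VS.

Lemma mem_shorten T u :
  reflect (u \in C /\ forall j, j \in T -> u 0 j = 0) (u \in shorten T).
Proof.
rewrite memv_cap; apply: (iffP andP) => -[uC uT]; split=> //.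
  by move=> j jT; move/subv_bigcapP: uT => /(_ j jT); rewrite -memvE memv_ker lfunE => /eqP.
by apply/subv_bigcapP => j jT; rewrite -memvE memv_ker lfunE; apply/eqP/uT.
Qed.

(** Rank-nullity for one linear form, whose image has dimension at most 1. *)
Lemma dim_shortenU1 T j : (\dim (shorten T) <= (\dim (shorten (j |: T))).+1)%N.
Proof.
have <- := limg_ker_dim (linfun (coordinate j)) (shorten T).
rewrite -[leqRHS]addn1 leq_add //.
  apply/dimvS/subvP => u; rewrite memv_cap => /andP[/mem_shorten[uC uT]].
  rewrite memv_ker lfunE => /eqP uj.
  by apply/mem_shorten; split=> // i /setU1P[->|/uT].
by rewrite (leq_trans (dimvS (subvf _))) // dimvf.
Qed.

Lemma dim_shortenU T U :
  (\dim (shorten T) <= \dim (shorten (T :|: U)) + #|U :\: T|)%N.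
Proof.
move mE: #|U :\: T| => m; elim: m U mE => [|m IHm] U mE.
  by move/eqP: mE; rewrite cards_eq0 setD_eq0 => /setUidPl->; rewrite addn0.
have /card_gt0P[j jUT] : (0 < #|U :\: T|)%N by rewrite mE.
have jU : j \in U by case/setDP: jUT.
rewrite addnS -addSn -[in T :|: U](setD1K jU) setUCA.
apply: leq_trans (IHm (U :\ j) _) _; last by rewrite leq_add2r dim_shortenU1.
by rewrite setDDl setUC -setDDl; move: mE; rewrite (cardsD1 j) jUT => -[].
Qed.

Lemma shorten_neq0 T :
  (0 < \dim (shorten T))%N -> exists i, exists2 u, u \in shorten T & u 0 i != 0.
Proof.
rewrite lt0n dimv_eq0 -vpick0 => /rV0Pn[i ui].
by exists i; exists (vpick (shorten T)); rewrite ?memv_pick.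
Qed.

Lemma shorten_extend T s : (s <= \dim (shorten T))%N ->
  exists2 T' : {set 'I_n}, #|T'| = (#|T| + s)%N &
    (\dim (shorten T) <= \dim (shorten T') + s)%N.
Proof.
elim: s => [|s IHs] s_le; first by exists T; rewrite addn0.
have [T' T'card T'dim] := IHs (ltnW s_le).
have /shorten_neq0[i [u /mem_shorten[_ uT'] ui]] : (0 < \dim (shorten T'))%N.
  by rewrite -(ltn_add2r s) (leq_trans s_le).
have iT' : i \notin T' by apply: contra ui => /uT' ->.
exists (i |: T'); first by rewrite cardsU1 iT' T'card addnS.
by rewrite addnS -addSn (leq_trans T'dim) // leq_add2r dim_shortenU1.
Qed.

(** Take a coordinate [i] where some word of [shorten T] is nonzero, and its repair set [I]. Only
    the [b] new coordinates of [I] can cost dimension; [i] itself comes free, which is the gain over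
    [shorten_extend]. *)
Lemma shorten_repair_group r T : has_locality C r ->
    (0 < \dim (shorten T))%N ->
  exists (T' : {set 'I_n}) b, [/\ (b <= r)%N, #|T'| = (#|T| + b).+1 &
    (\dim (shorten T) <= \dim (shorten T') + b)%N].
Proof.
move=> locC /shorten_neq0[i [u /mem_shorten[uC uT] ui]].
have [I [iI Ir repair]] := locC i.
have iT : i \notin T by apply: contra ui => /uT ->.
exists (i |: (T :|: I)), #|I :\: T|; split.
- by rewrite (leq_trans (subset_leq_card (subsetDl _ _))).
- rewrite cardsU1 !inE negb_or iT iI -(cardsID T (T :|: I)) setDUl setDv set0U.
  by rewrite setIC (setIidPl (subsetUl _ _)).
apply: leq_trans (dim_shortenU T I) _; rewrite leq_add2r.
apply/dimvS/subvP => w /mem_shorten[wC wTI].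
apply/mem_shorten; split=> // j /setU1P[->|/wTI//].
(* A word vanishing on [I] agrees there with the zero word, hence vanishes at [i]. *)
rewrite (repair w 0) ?mem0v ?mxE // => l lI.
by rewrite wTI ?mxE // inE lI orbT.
Qed.

(** Each [r] units of the rank budget [t] buy [r + 1] coordinates. A remainder below [r] buys one
    coordinate per unit. *)
Lemma shorten_large r t : has_locality C r -> (0 < r)%N ->
    (t <= \dim C)%N ->
  exists2 T : {set 'I_n}, (t + t %/ r <= #|T|)%N & (\dim C <= \dim (shorten T) + t)%N.
Proof.
move=> locC r_gt0; elim/ltn_ind: t => t IHt t_le.
have shorten0 : shorten set0 = C by rewrite /shorten big_set0 capvf.
have [t_lt|r_le] := ltnP t r.
  have [|T Tcard Tdim] := @shorten_extend set0 t; first by rewrite shorten0.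
  by exists T; rewrite ?Tcard ?cards0 ?divn_small ?addn0 // -[C in \dim C]shorten0.
have [||T Tcard Tdim] := IHt (t - r)%N; [lia..|].
have [|T' [b [b_le T'card T'dim]]] := @shorten_repair_group r T locC; first lia.
(* A group may cost only [b < r]; padding spends exactly [r], so that the quotient drops by one. *)
have [|T'' T''card T''dim] := @shorten_extend T' (r - b); first lia.
exists T''; last lia.
have -> : (t %/ r = ((t - r) %/ r).+1)%N.
  by rewrite -[in LHS](subnK r_le) divnDr // divnn r_gt0 addn1.
lia.
Qed.

Lemma shorten_weights d T : is_min_dist C d -> (1 < \dim (shorten T))%N ->
  ((#|F|.+1) * d <= #|F| * (n - #|T|))%N.
Proof.
move=> [_ distC] dimT.
have wtC w : w \in shorten T -> w != 0 -> (d <= #|[set j | (w 0 j != 0)%R]|)%N.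
  move=> /mem_shorten[wC _] w_neq0.
  have := distC w 0 wC (mem0v _) w_neq0; rewrite /hamming_dist.
  by under eq_finset do rewrite mxE.
set v := vpick (shorten T).
have vT : v \in shorten T by apply: memv_pick.
have v_neq0 : v != 0 by rewrite vpick0 -dimv_eq0 -lt0n ltnW.
have /subvPn[u uT uv] : ~~ (shorten T <= <[v]>)%VS.
  by apply: contraL dimT => /dimvS; rewrite dim_vline v_neq0 -leqNgt.
(* [option F] serves as the projective line over [F], with [None] as the point at infinity. *)
pose w (a : option F) : 'rV[F]_n := if a is Some a then u + a *: v else v.
have wT a : w a \in shorten T by case: a => [a|] //=; rewrite rpredD ?rpredZ.
have w_neq0 a : w a != 0.
  case: a => [a|] //=; apply: contra uv; rewrite addr_eq0 => /eqP->.
  by rewrite rpredN rpredZ // memv_line.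
have card_w : #|{: option F}| = #|F|.+1 by rewrite card_option.
(* Double counting of the pairs of a word and a coordinate outside [T] where it is nonzero. *)
apply: (@leq_trans (\sum_(a : option F) \sum_(j in ~: T) (w a 0 j != 0)%R)%N).
  rewrite -card_w -sum_nat_const leq_sum // => a _.
  rewrite (leq_trans (wtC _ (wT a) (w_neq0 a))) // -sum1dep_card.
  rewrite [leqRHS]big_mkcond [leqLHS]big_mkcond leq_sum // => j _.
  have [jT|jT] := boolP (j \in T); last by rewrite inE jT; case: eqP.
  by have /mem_shorten[_ ->] := wT a; rewrite ?eqxx.
have <- : #|~: T| = (n - #|T|)%N by rewrite cardsCs setCK card_ord.
rewrite exchange_big mulnC -sum_nat_const leq_sum // => j _.
have [a wa0] : exists a, w a 0 j = 0.
  have [vj0|vj] := eqVneq (v 0 j) 0; first by exists None.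
  by exists (Some (- (u 0 j / v 0 j))); rewrite /= !mxE mulNr divfK ?subrr.
rewrite (bigD1 a) //= wa0 eqxx add0n (leq_trans (leq_sum _ (fun _ _ => leq_b1 _))) //.
by rewrite sum1_card cardC1 card_w.
Qed.

End Shortening.

(** With [f = (k - 2) %/ r], division gives [k - 2 < (f + 1) * r], so [k <= (f + 2) * r] and the
    ceiling is at most [f + 2]. *)
Lemma singleton_optimal_defect n k d r : (2 <= r)%N -> (2 <= k)%N ->
  d%:Z = singleton_lrc_bound n k r -> (n <= d + (k - 2 + (k - 2) %/ r) + 2)%N.
Proof.
move=> r_ge2 k_ge2; rewrite /singleton_lrc_bound.
have : Num.ceil (k%:R / r%:R : rat) <= ((k - 2) %/ r + 2)%N%:Z.
  rewrite ceil_le_int // -pmulrn ler_pdivrMr ?ltr0n; last exact: ltnW.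
  by rewrite -natrM ler_nat; have := ltn_ceil (k - 2) (ltnW r_ge2); nia.
lia.
Qed.

Lemma singleton_optimal_dist (F : finFieldType) (n k d r : nat)
    (C : {vspace 'rV[F]_n}) :
  singleton_optimal_lrc k d r C -> (2 <= r)%N -> (r < k)%N ->
  (d <= 2 * #|F|)%N.
Proof.
move=> [[dimC distC locC] optC] r_ge2 r_lt.
(* The budget [k - 2] leaves dimension at least 2, as the pencil requires. *)
have [||T Tcard Tdim] := @shorten_large _ _ C r (k - 2) locC; [lia..|].
have := @shorten_weights _ _ C d T distC; rewrite -dimC in r_lt Tcard Tdim optC *.
have := singleton_optimal_defect r_ge2 _ optC.
nia.
Qed.

Theorem theorem3p5 (R : realType) :
  (forall lambda : R, 0 < lambda ->
     exists2 c : R, 0 < c &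
       forall (q : nat) (F : finFieldType) (n k d r : nat)
              (C : {vspace 'rV[F]_n}),
         #|F| = q -> singleton_optimal_lrc k d r C ->
         (2 <= r)%N -> (r < k)%N -> (2 * (r + 1) <= n)%N -> (3 <= d)%N ->
         lambda * n%:R <= d%:R ->
         n%:R <= c * q%:R)
  /\
  (forall (q : nat) (F : finFieldType) (n k d r : nat)
          (C : {vspace 'rV[F]_n}) (lambda : R),
     #|F| = q -> singleton_optimal_lrc k d r C ->
     (2 <= r)%N -> (r < k)%N -> (2 * (r + 1) <= n)%N -> (3 <= d)%N ->
     0 < lambda -> lambda < 1 -> d%:R = lambda * n%:R ->
     n%:R <= 2 * q%:R / lambda).
Proof.
have bound (q : nat) (F : finFieldType) (n k d r : nat)
    (C : {vspace 'rV[F]_n}) (lambda : R) :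
    #|F| = q -> singleton_optimal_lrc k d r C -> (2 <= r)%N -> (r < k)%N ->
    0 < lambda -> lambda * n%:R <= d%:R -> n%:R <= 2 * q%:R / lambda.
  move=> <- optC r_ge2 r_lt lambda_gt0 dn.
  rewrite ler_pdivlMr // mulrC (le_trans dn) // -natrM ler_nat.
  exact: singleton_optimal_dist optC r_ge2 r_lt.
split=> [lambda lambda_gt0|q F n k d r C lambda qF optC r2 rk _ _ l0 _ dn].
  exists (2 / lambda); first by rewrite divr_gt0.
  move=> q F n k d r C qF optC r2 rk _ _ dn.
  by rewrite mulrAC; apply: bound qF optC r2 rk lambda_gt0 dn.
by apply: bound qF optC r2 rk l0 _; rewrite dn.
Qed.
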